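(* Let $N$ be a prime integer, let $\Omega\subseteq\{0,\ldots,N-1\}$, and let $f\in\mathbb{C}^N$ be a vector supported on a set $T\subseteq\{0,\dots,N-1\}$ with $|T|\le \frac12|\Omega|$. Then $f$ can be reconstructed uniquely from $\Omega$ and $\hat f|_\Omega$; that is, if $g\in\mathbb{C}^N$ satisfies $|\mathrm{supp}(g)|\le\frac12|\Omega|$ and $\hat g(k)=\hat f(k)$ for all $k\in\Omega$, then $g=f$. Conversely, if $\Omega\neq\{0,\ldots,N-1\}$, then there exist distinct vectors $f,g\in\mathbb{C}^N$ such that $|\mathrm{supp}(f)|\le\frac12|\Omega|+1$, $|\mathrm{supp}(g)|\le \frac12|\Omega|+1$, and $\hat f|_\Omega=\hat g|_\Omega$.
   Context: For $f\in\mathbb{C}^N$, indexed by $t\in\mathbb{Z}_N=\{0,\dots,N-1\}$, the discrete Fourier transform is $\hat f(k)=\sum_{t=0}^{N-1}f(t)e^{-2\pi i kt/N}$, $k=0,\dots,N-1$. The support is $\mathrm{supp}(f)=\{t: f(t)\ne0\}$, and $|\cdot|$ denotes cardinality of a set. A vector is supported on $T$ if it vanishes outside $T$. *)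

(* Defs.v *)
From mathcomp Require Import all_boot all_order all_algebra.
From mathcomp Require Import reals trigo.
From mathcomp Require Export complex.

Set Implicit Arguments.
Unset Strict Implicit.
Unset Printing Implicit Defensive.

Import GRing.Theory Num.Theory.
Local Open Scope ring_scope.
Local Open Scope complex_scope.

(* e^(i x), by Euler's formula: the libraries have no complex exponential. *)
Definition expi (R : realType) (x : R) : R[i] := cos x +i* sin x.

Definition dft (R : realType) (N : nat) (f : {ffun 'I_N -> R[i]}) :
    {ffun 'I_N -> R[i]} :=
  [ffun k : 'I_N =>
    \sum_(t < N) f t * expi (- (2 * pi * k%:R * t%:R / N%:R))].

(* [0.-support f] of finfun, as a set. *)
Definition supp (R : realType) (N : nat) (f : {ffun 'I_N -> R[i]}) :
    {set 'I_N} := [set t in 0.-support f].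

(* Main.v *)
Require Import Defs.
From mathcomp Require Import all_boot all_order all_algebra.
From mathcomp Require Import reals complex trigo.
From mathcomp Require Import zify ring lra.
Import Order.TTheory GRing.Theory Num.Theory.
Local Open Scope ring_scope.
Local Open Scope complex_scope.

(* Uniqueness is Chebotarev's theorem that, for N prime, all square minors of
   the Fourier matrix are nonzero: the difference h of two solutions has at
   most |Omega| nonzero entries, so they are killed by an invertible minor.

   For Chebotarev's theorem, expand X^t in the Newton basis at the nodes
   x_m = z^(k_m), z a primitive p-th root of unity:
   X^t = sum_m N(t, m) prod_(l < m) (X - x_l), with
   N(t + 1, m) = x_m N(t, m) + N(t, m - 1).  As the nodes are distinct, a
   kernel vector of (x_i^(t_j)) is one of (N(t_j, m)).  The determinant of the
   latter is E(z) for an integer polynomial E; if it vanishes, p divides E(1).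
   But at z = 1 the recursion is Pascal's rule, so E(1) = det C(t_j, m), which
   is nonzero modulo p because the polynomials C(X, m), m < n <= p, are
   independent on any n points of F_p.

   Conversely, |Omega| equations in |Omega| + 1 unknowns have a nonzero
   solution h; cutting its support into two halves gives h = f - g. *)

(** * Newton expansion of monomials *)

(** The complete homogeneous symmetric polynomial of degree [t - m] in [x 0], ..., [x m], zero when
    [t < m]. Being free of division, the recursion also makes sense over [{poly int}]. *)
Fixpoint newton_coef {A : comNzRingType} (x : nat -> A) (t m : nat) : A :=
  match t with
  | 0 => (m == 0%N)%:R
  | t'.+1 => x m * newton_coef x t' m +
             (if m is m'.+1 then newton_coef x t' m' else 0)
  end.

Lemma newton_coefS {A : comNzRingType} (x : nat -> A) (t m : nat) :
  newton_coef x t.+1 m = x m * newton_coef x t m +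
    (if m is m'.+1 then newton_coef x t m' else 0).
Proof. by []. Qed.

Lemma newton_expand {A : comNzRingType} (x : nat -> A) (t i : nat) :
  x i ^+ t = \sum_(m < i.+1) newton_coef x t m * \prod_(l < m) (x i - x l).
Proof.
elim: t => [|t IH].
  rewrite big_ord_recl big_ord0 mulr1 /= big1 ?addr0 ?expr0 // => m _.
  by rewrite mul0r.
(* The shift of index adds only the term [m = i], whose product contains [x i - x i]. *)
have shift : \sum_(m < i.+1)
      (if (m : nat) is m'.+1 then newton_coef x t m' else 0) *
      \prod_(l < m) (x i - x l) =
    \sum_(m < i.+1) newton_coef x t m * \prod_(l < m.+1) (x i - x l).
  rewrite big_ord_recl /= mul0r add0r [RHS]big_ord_recr /=.
  by rewrite (big_ord_recr i) /= subrr !mulr0 addr0.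
rewrite exprS IH mulr_sumr.
under [RHS]eq_bigr do rewrite newton_coefS mulrDl.
rewrite big_split /= shift -big_split /=; apply: eq_bigr => m _.
by rewrite big_ord_recr /=; ring.
Qed.

Lemma eq_newton_coef {A : comNzRingType} (x y : nat -> A) (t m : nat) :
  x =1 y -> newton_coef x t m = newton_coef y t m.
Proof.
move=> xy; elim: t m => [//|t IH] m /=.
by rewrite xy IH; case: m => [|m]; rewrite ?IH.
Qed.

Lemma newton_coef_map {A B : comNzRingType} (phi : {rmorphism A -> B})
    (x : nat -> A) (t m : nat) :
  phi (newton_coef x t m) = newton_coef (phi \o x) t m.
Proof.
elim: t m => [|t IH] m /=; first by rewrite rmorph_nat.
by rewrite rmorphD rmorphM IH; case: m => [|m]; rewrite ?rmorph0 ?IH.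
Qed.

Lemma newton_coef1 {A : comNzRingType} (x : nat -> A) (t m : nat) :
  (forall l, x l = 1) -> newton_coef x t m = 'C(t, m)%:R.
Proof.
move=> x1; elim: t m => [|t IH] [|m] //=; rewrite x1 mul1r IH ?bin0 ?addr0 //.
by rewrite IH binS natrD.
Qed.

(* The matrix of the [prod_(l < m) (x i - x l)] is lower triangular, with
   invertible diagonal. *)
Lemma newton_kernel {F : fieldType} {J : finType} (n : nat) (x : nat -> F)
    (c : J -> F) (t : J -> nat) :
  {in gtn n &, injective x} ->
  (forall i, (i < n)%N -> \sum_j c j * x i ^+ t j = 0) ->
  forall m, (m < n)%N -> \sum_j c j * newton_coef x (t j) m = 0.
Proof.
move=> xI cx0; elim/ltn_ind => m IH mn; have := cx0 m mn.
under eq_bigr do rewrite newton_expand mulr_sumr.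
rewrite exchange_big big_ord_recr /= big1 ?add0r => [|l _]; last first.
  under eq_bigr do rewrite mulrA.
  by rewrite -mulr_suml IH ?mul0r // (ltn_trans _ mn).
under eq_bigr do rewrite mulrA.
rewrite -mulr_suml => /eqP; rewrite mulf_eq0 => /orP[/eqP //|].
rewrite prodf_seq_eq0 => /hasP[l _]; rewrite subr_eq0 => /eqP xml.
have lm := ltn_ord l; have ml := xI m l mn (ltn_trans lm mn) xml.
by rewrite -ml ltnn in lm.
Qed.

(** * Integer polynomials at roots of unity *)

Lemma sum_expr_unity_root {F : fieldType} (p i : nat) (z : F) :
  p.-primitive_root z -> \sum_(a < p) (z ^+ i) ^+ a = ((p %| i)%N * p)%:R.
Proof.
move=> zP; rewrite (prim_order_dvd zP); case: eqP => [->|/eqP zi1].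
  by under eq_bigr do rewrite expr1n; rewrite sumr_const card_ord mul1n.
have /esym/eqP := subrX1 (z ^+ i) p.
rewrite -exprM mulnC exprM (prim_expr_order zP) expr1n subrr mulf_eq0.
by rewrite subr_eq0 (negPf zi1) => /eqP.
Qed.

(* [G := prod_j E(X^j)], [0 < j < p], vanishes at every nontrivial p-th root
   of unity, so the average of [G] over all p-th roots of unity, which is
   an integer, is [E(1)^(p-1) / p]. *)
Lemma dvdz_horner1_unity_root {F : numFieldType} (p : nat) (z : F)
    (E : {poly int}) :
  prime p -> p.-primitive_root z -> root (map_poly intr E) z -> (p %| E.[1])%Z.
Proof.
move=> p_pr zP Ez0; have p0 := prime_gt0 p_pr; have p1 := prime_gt1 p_pr.
pose G : {poly int} := \prod_(1 <= j < p) (E \Po 'X^j).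
have G1 : G.[1] = E.[1] ^+ p.-1.
  rewrite horner_prod; under eq_bigr do rewrite horner_comp hornerXn expr1n.
  by rewrite prodr_const_nat subn1.
have Gz (a : nat) : (0 < a < p)%N -> (map_poly intr G).[z ^+ a] = 0.
  case/andP=> a0 ap; rewrite rmorph_prod horner_prod; apply/eqP.
  have := egcdnP p a0; case=> u v uv _.
  have acop : coprime a p by rewrite coprime_sym prime_coprime // gtnNdvd.
  rewrite (eqP acop) in uv.
  (* Since [u * a] is 1 modulo [p], the factor of [G] with [j = u %% p] takes at [z ^+ a] the value
     of [E] at [z]. *)
  rewrite prodf_seq_eq0; apply/hasP; exists (u %% p)%N.
    rewrite mem_index_iota ltn_mod p0 andbT lt0n.
    apply/negP => /(dvdn_mull a); rewrite mulnC => pua.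
    have : (p %| v * p + 1)%N by rewrite -uv.
    by rewrite dvdn_addr ?dvdn_mull // dvdn1 => /eqP pE; rewrite pE in p1.
  rewrite /= map_comp_poly map_polyXn horner_comp hornerXn -exprM.
  suff -> : z ^+ (a * (u %% p)) = z by exact: Ez0.
  rewrite -[RHS]expr1; apply/eqP; rewrite (eq_prim_root_expr zP).
  by rewrite modnMmr mulnC uv modnMDl.
have szG : (size (map_poly (intr : int -> F) G) <= size G)%N.
  by rewrite size_map_inj_poly //; apply: intr_inj.
have sumG : (map_poly intr G).[1] =
    p%:R * (\sum_(i < size G | (p %| i)%N) G`_i)%:~R :> F.
  (* Only [a = 0] contributes to this sum; expanded in coefficients, it keeps the indices divisible
     by [p]. *)
  transitivity (\sum_(a < p) (map_poly intr G).[z ^+ a]).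
    rewrite (bigD1 (Ordinal p0)) //= expr0 big1 ?addr0 // => a a_neq0.
    by apply: Gz; rewrite ltn_ord andbT lt0n.
  rewrite (rmorph_sum intr) mulr_sumr /=.
  under eq_bigr do rewrite (horner_coef_wide _ szG).
  rewrite exchange_big /= [RHS]big_mkcond; apply: eq_bigr => i _.
  under eq_bigr do rewrite coef_map /= -exprM mulnC exprM.
  rewrite -mulr_sumr (sum_expr_unity_root _ _ _ zP).
  by case: ifP; rewrite ?mul1n ?mul0n ?mulr0 // mulrC.
suff : (p %| G.[1])%Z.
  rewrite G1 !(dvdz_pcharf (pchar_Fp p_pr)) rmorphXn /=.
  by rewrite expf_eq0 => /andP[].
apply/dvdzP; exists (\sum_(i < size G | (p %| i)%N) G`_i).
apply: (@intr_inj F); rewrite rmorphM /= [RHS]mulrC -sumG.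
by have := horner_map (intr : int -> F) G 1; rewrite rmorph1.
Qed.

(** * Chebotarev's theorem *)

Lemma prod_subr_nat {A : comNzRingType} (t m : nat) :
  \prod_(l < m) (t%:R - l%:R) = (t ^_ m)%:R :> A.
Proof.
elim: m => [|m IH]; first by rewrite big_ord0.
rewrite big_ord_recr /= IH ffactnSr; case: (leqP m t) => mt.
  by rewrite natrM natrB.
by rewrite ffact_small // mul0n mul0r.
Qed.

Lemma det_bin_Fp_neq0 (p n : nat) (t : 'I_n -> 'I_p) :
  prime p -> injective t ->
  \det (\matrix_(m < n, j < n) ('C(t j, m)%:R : 'F_p)) != 0.
Proof.
move=> p_pr tI; apply/det0P => -[v v0 vC].
have np : (n <= p)%N by have := leq_card t tI; rewrite !card_ord.
have natF (a : nat) : (a%:R == 0 :> 'F_p) = (p %| a)%N.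
  by rewrite (dvdn_pcharf (pchar_Fp p_pr)).
(* As [m < n <= p], the polynomial C(X, m) can be formed over F_p. *)
have fact0 (m : 'I_n) : m`!%:R != 0 :> 'F_p.
  rewrite natF; have := ltn_ord m => /leq_trans /(_ np).
  elim: (m : nat) => [|k IH] kp; first by rewrite dvdn1 gtn_eqF ?prime_gt1.
  by rewrite factS Euclid_dvdM // negb_or IH ?gtnNdvd // ltnW.
pose Q : {poly 'F_p} :=
  \sum_(m < n) (v 0 m / m`!%:R) *: \prod_(l < m) ('X - l%:R%:P).
have Qt (a : nat) : Q.[a%:R] = \sum_(m < n) v 0 m * 'C(a, m)%:R.
  rewrite horner_sum; apply: eq_bigr => m _.
  rewrite hornerZ horner_prod; under eq_bigr do rewrite hornerXsubC.
  by rewrite prod_subr_nat -bin_ffact natrM mulrA mulrAC divfK.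
have Q0 : Q = 0.
  apply/eqP; apply/negP => /negP Qn0.
  have := max_poly_roots (rs := [seq (t j)%:R | j : 'I_n]) Qn0.
  rewrite size_map size_enum_ord ltnNge => /(_ _ _)/negP; apply.
  - apply/allP => _ /mapP[j _ ->]; rewrite /root Qt.
    by move/matrixP/(_ 0 j): vC; rewrite !mxE => vC;
       rewrite -[X in _ == X]vC; apply/eqP/eq_bigr => m _; rewrite mxE.
  - rewrite map_inj_uniq ?enum_uniq // => i j /(congr1 val) /=.
    by rewrite !val_Fp_nat // !modn_small // => /val_inj /tI.
  apply: leq_trans (size_sum _ _ _) _; apply/bigmax_leqP => m _.
  apply: leq_trans (size_scale_leq _ _) _.
  by rewrite size_prod_XsubC /= /index_enum -enumT size_enum_ord.
(* Evaluating [Q = 0] at 0, 1, 2, ... gives a unitriangular system for [v], because C(m, l) = 0 for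
   l > m. *)
case/negP: v0; apply/eqP/rowP => m; rewrite mxE.
elim/ltn_ind: {m}(m : nat) {-2}m (erefl (m : nat)) => k IH m mk.
have := Qt m; rewrite Q0 horner0 (bigD1 m) //= binn mulr1 big1 ?addr0 //.
move=> l lm; have [ml|] := ltnP m l; first by rewrite bin_small ?mulr0.
rewrite leq_eqVlt val_eqE (negPf lm) /= => lm'.
by rewrite (IH l) ?mul0r // -mk.
Qed.

Lemma chebotarev_minor_neq0 {F : numFieldType} (p n : nat) (z : F)
    (t k : 'I_n -> 'I_p) :
  prime p -> p.-primitive_root z -> injective t -> injective k ->
  \det (\matrix_(j < n, i < n) z ^+ (t j * k i)) != 0.
Proof.
case: n t k => [|n] t k p_pr zP tI kI; first by rewrite det_mx00 oner_neq0.
(* Lifting the nodes to powers of the indeterminate lets one determinant [E] specialise both to the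
   nodes, at [z], and to all nodes equal to 1. *)
pose X (l : nat) : {poly int} := 'X^(k (inord l)).
pose E := \det (\matrix_(m < n.+1, j < n.+1) newton_coef X (t j) m).
have E1 : ~~ (p %| E.[1])%Z.
  rewrite (dvdz_pcharf (pchar_Fp p_pr)).
  rewrite -/(horner_eval 1 E) -!det_map_mx.
  suff -> : map_mx intr (map_mx (horner_eval 1)
      (\matrix_(m < n.+1, j < n.+1) newton_coef X (t j) m)) =
      \matrix_(m < n.+1, j < n.+1) ('C(t j, m)%:R : 'F_p).
    exact: det_bin_Fp_neq0.
  apply/matrixP => m j; rewrite !mxE newton_coef_map newton_coef1 ?rmorph_nat //.
  by move=> l; rewrite /= /horner_eval hornerXn expr1n.
apply: contra E1 => /det0P[v v0 vM]; apply: (dvdz_horner1_unity_root _ z) => //.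
pose x (l : nat) := z ^+ k (inord l).
have xI : {in gtn n.+1 &, injective x}.
  move=> i j; rewrite !inE => i_lt j_lt /eqP.
  rewrite (eq_prim_root_expr zP) !modn_small // => /eqP /val_inj /kI.
  by move/(congr1 val); rewrite /= !inordK.
have vN : forall m, (m < n.+1)%N -> \sum_j v 0 j * newton_coef x (t j) m = 0.
  apply: newton_kernel => // i i_lt.
  move/matrixP/(_ 0 (inord i)): vM; rewrite !mxE => vM.
  by rewrite -[RHS]vM; apply: eq_bigr => j _; rewrite mxE -exprM mulnC.
rewrite /root -horner_evalE -!det_map_mx -det_tr; apply/det0P; exists v => //.
apply/matrixP => i m; rewrite !mxE ord1 -[RHS](vN m) //.
apply: eq_bigr => j _; rewrite !mxE !newton_coef_map.
congr (_ * _); apply: eq_newton_coef => l.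
by rewrite /= map_polyXn /horner_eval hornerXn.
Qed.

(** * The Fourier matrix as powers of a root of unity *)

Lemma expiD {R : realType} (x y : R) : expi (x + y) = expi x * expi y.
Proof.
rewrite /expi cosD sinD; apply/eqP; rewrite eq_complex /=.
by rewrite eqxx addrC eqxx.
Qed.

Lemma expiMn {R : realType} (x : R) (n : nat) : expi (x *+ n) = expi x ^+ n.
Proof.
elim: n => [|n IH]; first by rewrite /expi mulr0n cos0 sin0.
by rewrite mulrS expiD IH exprS.
Qed.

(** The order of this root of unity divides the prime [N] and is not 1. *)
Lemma expi_prim_root {R : realType} (N : nat) :
  prime N -> N.-primitive_root (expi (- (2 * pi / N%:R)) : R[i]).
Proof.
move=> N_pr; have N0 := prime_gt0 N_pr; have N1 := prime_gt1 N_pr.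
have N0R : N%:R != 0 :> R by rewrite pnatr_eq0 -lt0n.
set z := expi _.
have zN : z ^+ N = 1.
  rewrite /z -expiMn mulNrn -(mulr_natr (2 * pi / _) N) divfK // /expi cosN sinN.
  by rewrite mulr_natl cos2pi sin2pi oppr0.
have z1 : z != 1.
  apply/negP; rewrite eq_complex /= cosN => /andP[/eqP cos1 _].
  (* Cosine is injective on [0, pi], which contains 2 pi / N because N >= 2. *)
  have pi_itv : 2 * pi / N%:R \in `[0, (pi : R)].
    rewrite in_itv /= divr_ge0 ?mulr_ge0 ?pi_ge0 ?ler0n //=.
    by rewrite ler_pdivrMr ?ltr0n // mulrC ler_wpM2l ?pi_ge0 // ler_nat.
  have zero_itv : 0 \in `[0, (pi : R)] by rewrite in_itv /= lexx pi_ge0.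
  have /eqP := cos_inj pi_itv zero_itv (etrans cos1 (esym (@cos0 R))).
  by rewrite !mulf_eq0 invr_eq0 (negPf N0R) (gt_eqF (pi_gt0 R)) pnatr_eq0.
have [m zP mN] := prim_order_exists N0 zN.
have [_ /(_ m mN)] := primeP N_pr; move=> /orP[/eqP m1|/eqP <- //].
by move: (prim_expr_order zP); rewrite m1 expr1 => /eqP; rewrite (negPf z1).
Qed.

Lemma dft_expi_exp {R : realType} (N : nat) (f : {ffun 'I_N -> R[i]})
    (k : 'I_N) :
  dft f k = \sum_(t < N) f t * expi (- (2 * pi / N%:R)) ^+ (t * k).
Proof.
rewrite ffunE; apply: eq_bigr => t _.
rewrite -expiMn mulNrn -(mulr_natr (2 * pi / _) (t * k)) natrM.
by congr (_ * expi (- _)); ring.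
Qed.

Lemma dftB {R : realType} (N : nat) (f g : {ffun 'I_N -> R[i]}) (k : 'I_N) :
  dft (f - g) k = dft f k - dft g k.
Proof.
rewrite !ffunE -sumrB; apply: eq_bigr => t _.
by rewrite !ffunE mulrBl.
Qed.

(** * Vectors whose transform vanishes on [Omega] *)

Lemma dft_eq0_on {R : realType} (N : nat) (Omega : {set 'I_N})
    (h : {ffun 'I_N -> R[i]}) :
  prime N -> (#|supp h| <= #|Omega|)%N ->
  (forall k, k \in Omega -> dft h k = 0) -> h = 0.
Proof.
move=> N_pr hO hk0; set z := expi (- (2 * pi / N%:R)) : R[i].
have zP : N.-primitive_root z by apply: expi_prim_root.
(* The minor is square: its rows run over the support of [h], its columns over as many elements of
   [Omega]. *)
pose t (j : 'I_#|supp h|) := enum_val j.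
pose k (i : 'I_#|supp h|) := enum_val (widen_ord hO i).
have tI : injective t by apply: enum_val_inj.
have kI : injective k.
  by move=> i j /enum_val_inj /(congr1 val) /= /val_inj.
have h0 t0 : t0 \notin supp h -> h t0 = 0.
  by rewrite inE /= negbK => /eqP.
have := chebotarev_minor_neq0 N _ z t k N_pr zP tI kI.
move=> det_n0; apply/ffunP => t0; rewrite ffunE.
case: (boolP (t0 \in supp h)) => [t0h|/h0 //].
apply/eqP; apply: contraNT det_n0 => ht0; apply/det0P.
exists (\row_j h (t j)).
  apply/negP => /eqP/rowP/(_ (enum_rank_in t0h t0)); rewrite !mxE.
  by rewrite /t enum_rankK_in // => /eqP; rewrite (negPf ht0).
apply/rowP => i; rewrite !mxE -[RHS](hk0 (k i) (enum_valP _)) dft_expi_exp.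
rewrite [RHS](bigID (mem (supp h))) /= [X in _ + X]big1 ?addr0; last first.
  by move=> l /h0 ->; rewrite mul0r.
by rewrite [RHS]big_enum_val; apply: eq_bigr => j _; rewrite !mxE.
Qed.

(** A matrix with one more row than columns has a nonzero left kernel. Placing the unknowns on an
    initial segment lets the support be cut into two intervals. *)
Lemma dft_kernel {R : realType} (N : nat) (Omega : {set 'I_N}) :
  (#|Omega| < N)%N ->
  exists h : {ffun 'I_N -> R[i]},
    [/\ h <> 0, forall t : 'I_N, (#|Omega| < t)%N -> h t = 0 &
        forall k, k \in Omega -> dft h k = 0].
Proof.
move=> ON; set z := expi (- (2 * pi / N%:R)) : R[i].
pose M : 'M_(#|Omega|.+1, #|Omega|) :=
  \matrix_(j, i) z ^+ (j * @enum_val _ (mem Omega) i).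
have /matrix0Pn[i0 [j0 Mij]] : kermx M != 0.
  by rewrite kermx_eq0 /row_free neq_ltn ltnS rank_leq_col.
pose v := row i0 (kermx M).
have vM : v *m M = 0 by rewrite -row_mul mulmx_ker row0.
pose h := [ffun t : 'I_N => if (t <= #|Omega|)%N then v 0 (inord t) else 0].
exists h; split=> [/ffunP/(_ (widen_ord ON j0))|t Ot|k kO].
- by rewrite !ffunE /= -ltnS ltn_ord inord_val mxE => /eqP; rewrite (negPf Mij).
- by rewrite ffunE leqNgt Ot.
rewrite dft_expi_exp -/z.
move/rowP/(_ (enum_rank_in kO k)): vM; rewrite !mxE => vM.
rewrite -[RHS]vM; under [RHS]eq_bigr do rewrite [M _ _]mxE enum_rankK_in //.
rewrite (bigID (fun t : 'I_N => (t < #|Omega|.+1)%N)) /= addrC big1 ?add0r.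
  rewrite (big_ord_narrow ON); apply: eq_bigr => j _.
  by rewrite ffunE /= -ltnS ltn_ord inord_val.
by move=> t /negPf tO; rewrite ffunE -ltnS tO mul0r.
Qed.

Lemma card_supp_le {R : realType} (N a b : nat) (f : {ffun 'I_N -> R[i]}) :
  (forall t : 'I_N, f t != 0 -> (a <= t < b)%N) -> (#|supp f| <= b - a)%N.
Proof.
rewrite cardE -(size_map (@nat_of_ord N)) -[leqRHS](size_iota a) => fab.
apply: uniq_leq_size.
  by rewrite map_inj_uniq ?enum_uniq //; apply: val_inj.
move=> _ /mapP[t + ->]; rewrite mem_enum inE => /fab /andP[at_ tb].
by rewrite mem_iota at_ /= subnKC // ltnW // (leq_ltn_trans at_).
Qed.

Theorem theorem1p1 (R : realType) (N : nat) (hN : prime N)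
    (Omega : {set 'I_N}) :
  (forall (f : {ffun 'I_N -> R[i]}) (T : {set 'I_N}),
      (forall t : 'I_N, t \notin T -> f t = 0) ->
      #|T|%:R <= #|Omega|%:R / 2 :> rat ->
      forall g : {ffun 'I_N -> R[i]},
        #|supp g|%:R <= #|Omega|%:R / 2 :> rat ->
        (forall k : 'I_N, k \in Omega -> dft g k = dft f k) ->
        g = f)
  /\
  (Omega <> [set: 'I_N] ->
   exists f g : {ffun 'I_N -> R[i]},
     [/\ f <> g,
         #|supp f|%:R <= #|Omega|%:R / 2 + 1 :> rat,
         #|supp g|%:R <= #|Omega|%:R / 2 + 1 :> rat &
         forall k : 'I_N, k \in Omega -> dft f k = dft g k]).
Proof.
split=> [f T fT cT g cg gf|O_T].
  apply/eqP; rewrite -subr_eq0; apply/eqP.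
  apply: (dft_eq0_on _ Omega) => // [|k kO]; last by rewrite dftB gf ?subrr.
  (* Each of the two sets in the union has at most half the size of [Omega]. *)
  have sub : supp (g - f) \subset supp g :|: T.
    apply/subsetP => t; rewrite !inE /= !ffunE; apply: contraR.
    by rewrite negb_or negbK => /andP[/eqP -> /fT ->]; rewrite subrr.
  have cardU : (#|supp g :|: T| <= #|supp g| + #|T|)%N.
    by rewrite cardsU leq_subr.
  apply: leq_trans (subset_leq_card sub) (leq_trans cardU _).
  by rewrite -(ler_nat rat) natrD; lra.
have OltN : (#|Omega| < N)%N.
  rewrite -[X in (_ < X)%N]card_ord -cardsT proper_card // properT.
  exact/eqP.
have [h [h0 hO hk]] := @dft_kernel R N Omega OltN.
(* The [#|Omega| + 1] points are split into [m], rounded down, and the rest, rounded up; twice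
   either is at most [#|Omega| + 2]. *)
pose m := #|Omega|.+1./2.
pose f : {ffun 'I_N -> R[i]} := [ffun t : 'I_N => if (t < m)%N then h t else 0].
have half_le (j : nat) : (j.*2 <= #|Omega| + 2)%N ->
    j%:R <= #|Omega|%:R / 2 + 1 :> rat.
  by rewrite -(ler_nat rat) -muln2 natrM natrD; lra.
(* The second vector is [- h] on the points from [m] on and zero before, so the two differ by
   [h]. *)
exists f, (f - h); split.
- by move/eqP; rewrite eq_sym subr_eq addrC -subr_eq subrr eq_sym => /eqP.
- apply: half_le; rewrite (@leq_trans m.*2) //; last by rewrite /m; lia.
  rewrite leq_double -[m]subn0; apply: card_supp_le => t.
  by rewrite ffunE; case: ifP => //; rewrite eqxx.
- apply: half_le; rewrite (@leq_trans (#|Omega|.+1 - m).*2) //; last first.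
    by rewrite /m; lia.
  rewrite leq_double; apply: card_supp_le => t; rewrite !ffunE ltnS.
  case: ltnP => [_|_]; rewrite ?subrr ?eqxx //= leqNgt.
  by apply: contra => /hO ->; rewrite subrr.
by move=> k kO; rewrite dftB hk ?subr0.
Qed.
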